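(* Let $\mathcal{E}$ be a finite-dimensional Euclidean space, $\alpha\in(0,1)$, and let $T_1,\ldots,T_m:\mathcal{E}\to\mathcal{E}$ be $\alpha$-averaged operators such that $F:=\bigcap_{i=1}^m\mathrm{Fix}\,T_i$ is nonempty and $F\neq\mathcal{E}$. Let $\{x^k\}$ be generated by the quasi-cyclic algorithm $x^{k+1}=\sum_{i=1}^m w_i^kT_i(x^k)$, $k\in\mathbb{N}$, where $w_i^k\ge0$, $\sum_{i=1}^m w_i^k=1$, and $\nu:=\inf_{k\in\mathbb{N}}\min_{i\in I_+(k)}w_i^k>0$ with $I_+(k):=\{1\le i\le m\mid w_i^k>0\}$. Let $B$ be a bounded set containing $\{x^k\}$ and suppose that: (a) $T_1,\ldots,T_m$ are jointly Karamata regular (Karamata regular when $m=1$) over $B$; (b) there exists an integer $s>0$ such that for each $k\in\mathbb{N}$, $I_+(k)\cup\cdots\cup I_+(k+s-1)=\{1,\ldots,m\}$. Suppose in addition that $T_1,\ldots,T_m$ are all definable in a polynomially bounded $o$-minimal structure. Then either $\{x^k\}$ converges to some $x^*\in\bigcap_{i=1}^m\mathrm{Fix}\,T_i$ finitely, or there exist $r>0$ and $\kappa>0$ such that $$\mathrm{dist}(x^k,F)\le\kappa k^{-r}\quad\text{for all sufficiently large }k.$$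
   Context: $\mathbb{N}$ includes $0$. $\mathrm{Fix}\,T=\{x\mid T(x)=x\}$. $T$ is $\alpha$-averaged if $T=(1-\alpha)I+\alpha R$ for some nonexpansive $R$. ''Converges finitely'' means $x^k=x^*$ for all sufficiently large $k$. Regular variation at $0$: a Lebesgue measurable function $f:(0,a]\to(0,\infty)$ belongs to $\mathrm{RV}^0_\rho$ ($\rho\in\mathbb{R}$) if $\lim_{x\to0_+}f(\lambda x)/f(x)=\lambda^\rho$ for all $\lambda>0$. Joint Karamata regularity: operators $L_1,\ldots,L_n:\mathcal{E}\to\mathcal{E}$ with $C:=\bigcap_{i=1}^n\mathrm{Fix}\,L_i\ne\emptyset$ are jointly Karamata regular over a bounded set $B$ if there is a function $\psi_B:\mathbb{R}_+\to\mathbb{R}_+$ such that: (1) $\mathrm{dist}(x,C)\le\psi_B(\max_{1\le i\le n}\|x-L_i(x)\|)$ for all $x\in B$; (2) $\psi_B$ is nondecreasing with $\lim_{t\to0_+}\psi_B(t)=\psi_B(0)=0$; (3) for some $a>0$, $\psi_B|_{(0,a]}\in\mathrm{RV}^0_\rho$ for some $\rho\in[0,1]$. For $n=1$ one says ''Karamata regular''. $o$-minimal structure on $(\mathbb{R},+,\cdot)$: a sequence of Boolean algebras $\mathcal{O}_n$ of subsets of $\mathbb{R}^n$ such that for each $n$: (1) $A\in\mathcal{O}_n$ implies $A\times\mathbb{R},\mathbb{R}\times A\in\mathcal{O}_{n+1}$; (2) $\pi(A)\in\mathcal{O}_n$ for all $A\in\mathcal{O}_{n+1}$, where $\pi(x_1,\ldots,x_{n+1})=(x_1,\ldots,x_n)$;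 (3) $\mathcal{O}_n$ contains every set $\{x\in\mathbb{R}^n\mid p(x)=0\}$ with $p$ a polynomial; (4) the elements of $\mathcal{O}_1$ are exactly the finite unions of intervals and points. Sets in $\mathcal{O}_n$ are definable; a function $f:\mathbb{R}^n\to\mathbb{R}^m$ is definable if its graph is in $\mathcal{O}_{n+m}$. The structure is polynomially bounded if for every definable $f:\mathbb{R}\to\mathbb{R}$ there is a natural number $N$ with $|f(x)|\le x^N$ for all sufficiently large $x$. $\mathcal{E}$ is identified with some $\mathbb{R}^d$ via an orthonormal basis. *)

(* Defs.v *)
From mathcomp Require Import all_boot all_order all_algebra.
From mathcomp Require Import all_classical all_reals all_analysis.
From mathcomp Require mpoly.

Set Implicit Arguments.
Unset Strict Implicit.
Unset Printing Implicit Defensive.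

Import Order.TTheory GRing.Theory Num.Theory.
Import numFieldNormedType.Exports.

Local Open Scope classical_set_scope.
Local Open Scope ring_scope.

(* MathComp-Analysis equips 'rV[R]_d with the sup norm, so the Euclidean norm
   and the notions derived from it are defined here. *)

Definition enorm (R : realType) (d : nat) (x : 'rV[R]_d) : R :=
  Num.sqrt (\sum_(i < d) x 0 i ^+ 2).

Definition edistance (R : realType) (d : nat) (x : 'rV[R]_d)
    (C : set 'rV[R]_d) : R :=
  inf [set enorm (x - y) | y in C].

Definition ebounded (R : realType) (d : nat) (B : set 'rV[R]_d) : Prop :=
  exists M : R, forall x, B x -> enorm x <= M.

Definition Fix (V : Type) (T : V -> V) : set V := [set x | T x = x].

Definition common_Fix (V : Type) (n : nat) (L : 'I_n -> V -> V) : set V :=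
  \bigcap_(i in [set: 'I_n]) Fix (L i).

Definition nonexpansive (R : realType) (d : nat)
    (T : 'rV[R]_d -> 'rV[R]_d) : Prop :=
  forall x y, enorm (T x - T y) <= enorm (x - y).

Definition averaged (R : realType) (d : nat) (alpha : R)
    (T : 'rV[R]_d -> 'rV[R]_d) : Prop :=
  exists2 N : 'rV[R]_d -> 'rV[R]_d, nonexpansive N &
    forall x, T x = (1 - alpha) *: x + alpha *: N x.

(* The domain carries the Lebesgue (Caratheodory) sigma-algebra, that is, the
   one on which completed_lebesgue_measure is defined; the codomain carries the
   Borel sigma-algebra. *)
Definition lebesgue_measurable_fun (R : realType) (D : set R) (f : R -> R) :
    Prop :=
  @measurable_fun _ _
    (caratheodory_type (wlength (idfun : R -> R))^*%mu) (measurableTypeR R)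
    D f.

(* A function on ]0, a] is represented by a total function whose values outside
   ]0, a] are irrelevant: when x tends to 0 from the right, both x and
   lambda * x eventually lie in ]0, a]. *)
Definition RV0 (R : realType) (a rho : R) (f : R -> R) : Prop :=
  [/\ lebesgue_measurable_fun `]0, a] f,
      forall x : R, 0 < x <= a -> 0 < f x &
      forall lambda : R, 0 < lambda ->
        f (lambda * x) / f x @[x --> 0^'+] --> lambda `^ rho].

(* A function from R_+ to R_+ is represented by a total function whose values
   at negative reals are irrelevant.  The norms being nonnegative, the neutral
   element 0 does not alter the maximum. *)
Definition jointly_Karamata_regular (R : realType) (d n : nat)
    (L : 'I_n -> 'rV[R]_d -> 'rV[R]_d) (B : set 'rV[R]_d) : Prop :=
  [/\ common_Fix L !=set0, ebounded B &
  exists psi : R -> R,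
    [/\ forall t : R, 0 <= t -> 0 <= psi t,
        forall x, B x -> edistance x (common_Fix L) <=
          psi (\big[Num.max/0]_(i < n) enorm (x - L i x)),
        forall s t : R, 0 <= s -> s <= t -> psi s <= psi t,
        psi t @[t --> 0^'+] --> 0 /\ psi 0 = 0 &
        exists a rho : R, [/\ 0 < a, 0 <= rho <= 1 & RV0 a rho psi]]].

(* O n is the collection of definable subsets of R^n.  A product A x R (resp.
   R x A) is described by a condition on the first (resp. last) n coordinates
   of a vector; a point c is the interval `[c, c]. *)
Record o_minimal (R : realType) (O : forall n, set (set 'rV[R]_n)) : Prop := {
  omin_set0 : forall n, O n set0 ;
  omin_setT : forall n, O n setT ;
  omin_setC : forall n A, O n A -> O n (~` A) ;
  omin_setU : forall n A B, O n A -> O n B -> O n (A `|` B) ;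
  omin_setI : forall n A B, O n A -> O n B -> O n (A `&` B) ;
  omin_setXT : forall n A, O n A ->
    O (n + 1)%N [set x : 'rV[R]_(n + 1) | A (lsubmx x)] ;
  omin_setTX : forall n A, O n A ->
    O (1 + n)%N [set x : 'rV[R]_(1 + n) | A (rsubmx x)] ;
  omin_proj : forall n (A : set 'rV[R]_(n + 1)), O (n + 1)%N A ->
    O n [set lsubmx x | x in A] ;
  omin_poly : forall n (p : mpoly.mpoly n R),
    O n [set x : 'rV[R]_n | mpoly.meval (fun i => x 0 i) p = 0] ;
  omin_O1 : forall A : set 'rV[R]_1, O 1%N A <->
    exists s : seq (interval R),
      A = [set x | exists2 J, J \in s & x 0 0 \in J] }.

Definition definable_fun (R : realType) (O : forall n, set (set 'rV[R]_n))
    (n m : nat) (f : 'rV[R]_n -> 'rV[R]_m) : Prop :=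
  O (n + m)%N [set row_mx x (f x) | x in [set: 'rV[R]_n]].

Definition polynomially_bounded (R : realType)
    (O : forall n, set (set 'rV[R]_n)) : Prop :=
  forall f : R -> R,
    definable_fun O (fun x : 'rV[R]_1 => \row_(j < 1) f (x 0 0)) ->
    exists N : nat, \forall x \near +oo, `|f x| <= x ^+ N.

Definition Iplus (R : realType) (m : nat) (w : nat -> 'I_m -> R) (k : nat) :
    {set 'I_m} :=
  [set i | 0 < w k i]%SET.

(* For weights that are nonnegative and sum to 1, Iplus w k is nonempty and all
   weights are at most 1, so the neutral element 1 does not alter the
   minimum. *)
Definition weight_inf (R : realType) (m : nat) (w : nat -> 'I_m -> R) : R :=
  inf [set \big[Num.min/1]_(i in Iplus w k) w k i | k in [set: nat]].

(* Main.v *)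
Require Import Defs.
From mathcomp Require Import all_boot all_order all_algebra.
From mathcomp Require Import all_classical all_reals all_analysis.
From mathcomp Require Import (canonicals) mpoly.
From mathcomp Require Import ring lra zify.
Import Order.TTheory GRing.Theory Num.Theory.
Import numFieldNormedType.Exports.
Local Open Scope classical_set_scope.
Local Open Scope ring_scope.

(* The point is a Hoelder error bound: on a ball, a power of dist(x, F) is at
   most a constant times the residual sum_i |x - T_i x|^2.  Let f(s) be the
   maximum of 1 / residual over the points of the ball at distance at least 1/s
   from F.  It is attained by compactness, and f is definable because it is
   described by a first-order formula, so polynomial boundedness gives
   1 / residual(x) <= s^N with s of the order of 1 / dist(x, F).

   By averagedness, u = dist^2 decreases over a block of s steps by a multiple
   of the residual at its start, hence by a multiple of u^(q+2).  For v equal to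
   a suitable multiple of u^(q+1) this gives v' <= v (1 - v), whence v = O(1/k).
   So the rate holds even when the convergence is finite. *)

(** * First-order closure properties of definable sets and functions *)

Section Definability.
Variables (R : realType) (O : forall n, set (set 'rV[R]_n)).
Local Set Implicit Arguments.
Local Unset Strict Implicit.
Hypothesis omin : o_minimal O.

(** Real values are read as vectors of length 1, so that the closure properties of [definable_fun]
    apply to them. *)
Definition definable_real n (h : 'rV[R]_n -> R) : Prop :=
  definable_fun O (fun x => const_mx (h x) : 'rV[R]_1).

Lemma definable_forall_ord n k (F : 'I_k -> set 'rV[R]_n) :
  (forall i, O n (F i)) -> O n [set x | forall i, F i x].
Proof.
move=> DF; suff DFs (s : seq 'I_k) : O n [set x | forall i, i \in s -> F i x].
  have -> : [set x | forall i, F i x] =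
      [set x | forall i, i \in enum 'I_k -> F i x].
    by apply/seteqP; split=> x Fx i => [_|]; apply: Fx; rewrite mem_enum.
  exact: DFs.
elim: s => [|i s IHs].
  rewrite (_ : [set x | _] = setT); first exact: (omin_setT omin).
  by apply/seteqP; split.
rewrite (_ : [set x | _] = F i `&` [set x | forall j, j \in s -> F j x]).
  exact: (omin_setI omin).
apply/seteqP; split=> [x Fx|x [Fix Fsx] j].
  by split=> [|j js]; apply: Fx; rewrite inE ?eqxx ?js ?orbT.
by rewrite inE => /predU1P[->//|]; exact: Fsx.
Qed.

Lemma definable_rsubmx_preimage n k (A : set 'rV[R]_k) :
  O k A -> O (n + k) [set v | A (rsubmx v)].
Proof.
move=> DA; elim: n => [|n IHn].
  rewrite (_ : [set v | _] = A)//.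
  have rid (v : 'rV[R]_(0 + k)) : rsubmx v = v.
    by apply/rowP=> j; rewrite mxE; congr (v _ _); apply: val_inj.
  by apply/seteqP; split=> v /=; rewrite rid.
have := omin_setTX omin IHn.
congr (O _ _); apply/seteqP; split=> v /=; congr A; apply/rowP => j;
  by rewrite !mxE; congr (v _ _); apply: val_inj.
Qed.

Lemma definable_castmx n n' (e : n = n') (A : set 'rV[R]_n) :
  O n A -> O n' [set x | A (castmx (erefl, esym e) x)].
Proof.
move=> DA; case: n' / e; rewrite (_ : [set x | _] = A); first exact: DA.
by apply/seteqP; split=> v /=; rewrite castmx_id.
Qed.

(** Projection removes one last coordinate at a time, so the induction on [k] regroups n + (k + 1)
    coordinates as (n + 1) + k; most of the work is this cast. *)
Lemma definable_exists n k (A : set 'rV[R]_(n + k)) :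
  O (n + k) A -> O n [set x | exists y, A (row_mx x y)].
Proof.
elim: k n A => [|k IHk] n A DA.
  have := definable_castmx (addn0 n) DA; congr (O _ _).
  have e (x : 'rV[R]_n) y : row_mx x y = castmx (erefl, esym (addn0 n)) x.
    apply/rowP => j; rewrite castmxE/=.
    have j_lt : (j < n)%N by rewrite -[X in (_ < X)%N]addn0.
    rewrite (_ : j = lshift 0 (Ordinal j_lt)) ?row_mxEl; last exact: val_inj.
    by congr (x _ _); apply: val_inj.
  apply/seteqP; split=> x /=; first by exists 0; rewrite e.
  by case=> y; rewrite e.
have en : (n + k.+1 = n + 1 + k)%N by rewrite -addnA add1n.
have /IHk/(omin_proj omin) := definable_castmx en DA.
congr (O _ _).
have e (x : 'rV[R]_n) (u : 'rV[R]_1) (y : 'rV[R]_k) :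
    castmx (erefl, esym en) (row_mx (row_mx x u) y) =
    row_mx x (row_mx u y : 'rV_(1 + k)).
  apply/rowP => j; rewrite castmxE/=; case: (split_ordP j) => {}j -> /=.
    rewrite (_ : cast_ord _ _ = lshift k (lshift 1 j)); last exact: val_inj.
    by rewrite !row_mxEl; congr (x _ _); apply: val_inj.
  case: (@split_ordP 1 k j) => {}j ->; rewrite row_mxEr.
    rewrite (_ : cast_ord _ _ = lshift k (rshift n j)); last exact: val_inj.
    rewrite !row_mxEl row_mxEr (@row_mxEl _ _ 1 k).
    by congr (u _ _); apply: val_inj.
  rewrite [X in _ _ _ X](_ : _ = rshift (n + 1) j).
    by rewrite !(row_mxEr, @row_mxEr _ _ 1 k); congr (y _ _); apply: val_inj.
  by apply: val_inj; rewrite /= addnA.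
apply/seteqP; split=> x /=.
  case=> v [y Av] <-; exists (row_mx (rsubmx v) y : 'rV_(1 + k)).
  by rewrite -e hsubmxK.
case=> y Ay; exists (row_mx x (lsubmx (y : 'rV_(1 + k)))).
  by exists (rsubmx (y : 'rV_(1 + k))); rewrite e hsubmxK.
by rewrite row_mxKl.
Qed.

Lemma definable_forall n k (A : set 'rV[R]_(n + k)) :
  O (n + k) A -> O n [set x | forall y, A (row_mx x y)].
Proof.
move=> /(omin_setC omin)/definable_exists/(omin_setC omin).
congr (O _ _); apply/seteqP; split=> x /=; last by move=> Ax [y]; apply.
by move=> nAx y; apply: contrapT => nA; apply: nAx; exists y.
Qed.

(** The preimage is the projection of the graph of [f] intersected with the cylinder over [A]. *)
Lemma definable_preimage n k (f : 'rV[R]_n -> 'rV[R]_k) (A : set 'rV[R]_k) :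
  definable_fun O f -> O k A -> O n (f @^-1` A).
Proof.
move=> Df /(definable_rsubmx_preimage n) /(omin_setI omin Df).
move=> /definable_exists; congr (O _ _); apply/seteqP; split=> x /=.
  by move=> [y [[x' _ /eq_row_mx[-> ->]]]]; rewrite row_mxKr.
by move=> Afx; exists (f x); split; [exists x|rewrite row_mxKr].
Qed.

(** The graph is cut out by the linear equations y_j = x_(s j). This allows coordinates to be
    permuted, repeated or dropped, hence variables of a formula to be renamed. *)
Lemma definable_reindex n k (s : 'I_k -> 'I_n) :
  definable_fun O (fun x => \row_j x 0 (s j)).
Proof.
rewrite /definable_fun.
pose X (i : 'I_(n + k)) := mpoly.mpolyX R (mpoly.mnm1 i).
have := definable_forall_ord (fun j =>
  omin_poly omin (X (rshift n j) - X (lshift k (s j)))).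
congr (O _ _); apply/seteqP; split=> v /=.
  move=> ev; exists (lsubmx v) => //; rewrite -[RHS]hsubmxK; congr row_mx.
  apply/rowP => j; rewrite !mxE; have /esym/eqP := ev j.
  by rewrite mpoly.mevalB !mpoly.mevalXU eq_sym subr_eq0 => /eqP.
move=> [x _ <-] j; rewrite mpoly.mevalB !mpoly.mevalXU row_mxEr row_mxEl mxE.
by rewrite subrr.
Qed.

Lemma definable_reindex2 n k l (s : 'I_k -> 'I_n) (t : 'I_l -> 'I_n)
    (A : set 'rV[R]_(k + l)) :
  O (k + l) A -> O n [set u | A (row_mx (\row_j u 0 (s j)) (\row_j u 0 (t j)))].
Proof.
pose st j := match fintype.split j with inl a => s a | inr b => t b end.
move=> /(definable_preimage (definable_reindex st)); congr (O _ _).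
apply/seteqP; split=> u /=; congr A; apply/rowP => j; rewrite !mxE /st;
  by case: fintype.split => a; rewrite mxE.
Qed.

(** The graph of the composite is the set of (x, z) for which some y has (x, y) in the graph of [f]
    and (y, z) in that of [g]; the variables are laid out as x, z, y so that y is projected away. *)
Lemma definable_comp n k l (f : 'rV[R]_n -> 'rV[R]_k) (g : 'rV[R]_k -> 'rV[R]_l) :
  definable_fun O f -> definable_fun O g -> definable_fun O (fun x => g (f x)).
Proof.
move=> Df Dg.
have Df' := definable_reindex2 (fun j => lshift k (lshift l j)) (@rshift (n + l) k) Df.
have Dg' := definable_reindex2 (@rshift (n + l) k) (fun j => lshift k (rshift n j)) Dg.
have := definable_exists (omin_setI omin Df' Dg'); congr (O _ _).
have el (v : 'rV[R]_(n + l)) (y : 'rV[R]_k) :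
    \row_j row_mx v y 0 (lshift k (lshift l j)) = lsubmx v.
  by apply/rowP => j; rewrite mxE row_mxEl mxE.
have er (v : 'rV[R]_(n + l)) (y : 'rV[R]_k) :
    \row_j row_mx v y 0 (lshift k (rshift n j)) = rsubmx v.
  by apply/rowP => j; rewrite mxE row_mxEl mxE.
have ey (v : 'rV[R]_(n + l)) (y : 'rV[R]_k) :
    \row_j row_mx v y 0 (rshift (n + l) j) = y.
  by apply/rowP => j; rewrite mxE row_mxEr.
apply/seteqP; split=> v /=.
  move=> [y]; rewrite el er ey => -[[x _ /eq_row_mx[xE yE]] [y' _ /eq_row_mx[-> zE]]].
  by exists x; rewrite // yE zE xE hsubmxK.
move=> [x _ <-]; exists (f x); rewrite el er ey row_mxKl row_mxKr.
by split; [exists x|exists (f x)].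
Qed.

Lemma definable_lsubmx n k : definable_fun O (@lsubmx R 1 n k).
Proof.
have := definable_reindex (@lshift n k); congr definable_fun.
by apply/funext => v; apply/rowP => j; rewrite !mxE.
Qed.

Lemma definable_rsubmx n k : definable_fun O (@rsubmx R 1 n k).
Proof.
have := definable_reindex (@rshift n k); congr definable_fun.
by apply/funext => v; apply/rowP => j; rewrite !mxE.
Qed.

Lemma definable_coord n (j : 'I_n) : definable_real (fun x => x 0 j).
Proof.
have := definable_reindex (fun _ : 'I_1 => j); congr definable_fun.
by apply/funext => v; apply/rowP => i; rewrite !mxE.
Qed.

Lemma definable_real_comp n k (f : 'rV[R]_n -> 'rV[R]_k) (h : 'rV[R]_k -> R) :
  definable_fun O f -> definable_real h -> definable_real (fun x => h (f x)).
Proof. exact: definable_comp. Qed.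

(** The graph is the finite intersection of the graphs of the components, each read in the larger
    space. *)
Lemma definable_row n k (f : 'rV[R]_n -> 'rV[R]_k) :
  (forall j, definable_real (fun x => f x 0 j)) -> definable_fun O f.
Proof.
move=> Df; rewrite /definable_fun.
have := definable_forall_ord (fun j => definable_reindex2 (@lshift n k)
  (fun _ => rshift n j) (Df j)); congr (O _ _).
apply/seteqP; split=> v /=.
  move=> Dv; exists (lsubmx v) => //; rewrite -[RHS]hsubmxK; congr row_mx.
  apply/rowP => j; have [x _ /eq_row_mx[xE /rowP/(_ 0)]] := Dv j.
  rewrite !mxE => <-; congr (f _ _ _); rewrite xE.
  by apply/rowP => i; rewrite !mxE.
move=> [x _ <-] j; exists x => //; congr row_mx; apply/rowP => i.
  by rewrite mxE row_mxEl.
by rewrite mxE row_mxEr mxE.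
Qed.

(** The polynomial [p] in three variables vanishes exactly on the graph of [op]; composing with the
    pair of [h1] and [h2] gives the claim. Sum, product and difference are instances. *)
Lemma definable_real_op2 (op : R -> R -> R) (p : mpoly.mpoly (2 + 1) R) n
    (h1 h2 : 'rV[R]_n -> R) :
  (forall v : 'I_(2 + 1) -> R, mpoly.meval v p =
     v (rshift 2 0) - op (v (lshift 1 0)) (v (lshift 1 1))) ->
  definable_real h1 -> definable_real h2 ->
  definable_real (fun x => op (h1 x) (h2 x)).
Proof.
move=> pE D1 D2; pose f x := \row_(j < 2) if j == 0 then h1 x else h2 x.
have Df : definable_fun O f.
  apply: definable_row => j; rewrite /f; case: (eqVneq j 0) => j0.
    move: D1; congr (definable_real _).
    by apply/funext => x; rewrite mxE j0.
  move: D2; congr (definable_real _).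
  by apply/funext => x; rewrite mxE (negbTE j0).
have Dop : definable_real (fun y : 'rV[R]_2 => op (y 0 0) (y 0 1)).
  rewrite /definable_real/definable_fun.
  have := omin_poly omin p; congr (O _ _); apply/seteqP; split=> v /=.
    rewrite pE => /eqP; rewrite subr_eq0 => /eqP vE; exists (lsubmx v) => //.
    rewrite -[RHS]hsubmxK; congr row_mx; apply/rowP => j.
    by rewrite !mxE ord1 vE.
  by move=> [y _ <-]; rewrite pE !row_mxEl row_mxEr mxE subrr.
have := definable_real_comp Df Dop; congr (definable_real _).
by apply/funext => x; rewrite !mxE.
Qed.

Lemma definable_cst n (c : R) : definable_real (fun _ : 'rV[R]_n => c).
Proof.
rewrite /definable_real/definable_fun.
have := omin_poly omin (mpoly.mpolyX R (mpoly.mnm1 (rshift n 0)) -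
  mpoly.mpolyC (n + 1) c); congr (O _ _); apply/seteqP; split=> v /=.
  rewrite mpoly.mevalB mpoly.mevalXU mpoly.mevalC => /eqP.
  rewrite subr_eq0 => /eqP vE; exists (lsubmx v) => //.
  by rewrite -[RHS]hsubmxK; congr row_mx; apply/rowP => j; rewrite !mxE ord1 vE.
move=> [y _ <-]; rewrite mpoly.mevalB mpoly.mevalXU mpoly.mevalC.
by rewrite row_mxEr mxE subrr.
Qed.

Lemma definable_add n (h1 h2 : 'rV[R]_n -> R) : definable_real h1 ->
  definable_real h2 -> definable_real (fun x => h1 x + h2 x).
Proof.
pose X (i : 'I_(2 + 1)) := mpoly.mpolyX R (mpoly.mnm1 i).
apply: (@definable_real_op2 +%R
  (X (rshift 2 0) - (X (lshift 1 0) + X (lshift 1 1)))) => v.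
by rewrite mpoly.mevalB mpoly.mevalD !mpoly.mevalXU.
Qed.

Lemma definable_mul n (h1 h2 : 'rV[R]_n -> R) : definable_real h1 ->
  definable_real h2 -> definable_real (fun x => h1 x * h2 x).
Proof.
pose X (i : 'I_(2 + 1)) := mpoly.mpolyX R (mpoly.mnm1 i).
apply: (@definable_real_op2 *%R
  (X (rshift 2 0) - (X (lshift 1 0) * X (lshift 1 1)))) => v.
by rewrite mpoly.mevalB mpoly.mevalM !mpoly.mevalXU.
Qed.

Lemma definable_sub n (h1 h2 : 'rV[R]_n -> R) : definable_real h1 ->
  definable_real h2 -> definable_real (fun x => h1 x - h2 x).
Proof.
pose X (i : 'I_(2 + 1)) := mpoly.mpolyX R (mpoly.mnm1 i).
apply: (@definable_real_op2 (fun a b => a - b)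
  (X (rshift 2 0) - (X (lshift 1 0) - X (lshift 1 1)))) => v.
by rewrite !mpoly.mevalB !mpoly.mevalXU.
Qed.

Lemma definable_sum n k (h : 'I_k -> 'rV[R]_n -> R) :
  (forall i, definable_real (h i)) ->
  definable_real (fun x => \sum_(i < k) h i x).
Proof.
elim: k h => [|k IHk] h Dh.
  have := @definable_cst n 0; congr (definable_real _).
  by apply/funext => x; rewrite big_ord0.
have := definable_add (IHk _ (fun i => Dh (widen_ord (leqnSn k) i))) (Dh ord_max).
congr (definable_real _).
by apply/funext => x; rewrite big_ord_recr.
Qed.

(** The order enters through the description of the definable subsets of the line: a half-line is an
    interval, and its preimage is definable. *)
Lemma definable_ge0 n (h : 'rV[R]_n -> R) :
  definable_real h -> O n [set x | 0 <= h x].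
Proof.
move=> Dh; have /(definable_preimage Dh) : O 1%N [set x : 'rV[R]_1 | 0 <= x 0 0].
  apply/(omin_O1 omin); exists [:: `[0, +oo[]; apply/seteqP; split=> x /=.
  move=> x0; exists `[0, +oo[; first by rewrite inE.
    by rewrite in_itv/= x0.
  by case=> J; rewrite inE => /eqP ->; rewrite in_itv/= andbT.
by congr (O _ _); apply/seteqP; split=> x /=; rewrite mxE.
Qed.

Lemma definable_le n (h1 h2 : 'rV[R]_n -> R) : definable_real h1 ->
  definable_real h2 -> O n [set x | h1 x <= h2 x].
Proof.
move=> D1 D2; have := definable_ge0 (definable_sub D2 D1); congr (O _ _).
by apply/seteqP; split=> x /=; rewrite subr_ge0.
Qed.

Lemma definable_eq n (h1 h2 : 'rV[R]_n -> R) : definable_real h1 ->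
  definable_real h2 -> O n [set x | h1 x = h2 x].
Proof.
move=> D1 D2.
have := omin_setI omin (definable_le D1 D2) (definable_le D2 D1).
congr (O _ _); apply/seteqP; split=> x /=; last by move->.
by move=> [? ?]; apply/le_anti/andP.
Qed.

End Definability.

(** * The squared Euclidean norm, the distance to a set, and compactness *)

Section SquaredNorm.
Context {R : realType} {d : nat}.
Implicit Types (x y z : 'rV[R]_d) (C : set 'rV[R]_d).


(** The square is polynomial in the coordinates, hence definable, and the estimates for averaged
    maps are identities between squares. *)
Definition sqnorm x : R := \sum_(j < d) x 0 j ^+ 2.

Lemma sqnorm_ge0 x : 0 <= sqnorm x.
Proof. by apply: sumr_ge0 => j _; exact: sqr_ge0. Qed.

Lemma sqr_enorm x : enorm x ^+ 2 = sqnorm x.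
Proof. by rewrite sqr_sqrtr// sqnorm_ge0. Qed.

Lemma enorm_ge0 x : 0 <= enorm x. Proof. exact: sqrtr_ge0. Qed.

Lemma sqnorm0 : sqnorm 0 = 0.
Proof. by rewrite /sqnorm big1// => j _; rewrite mxE expr0n. Qed.

Lemma sqnorm_eq0 x : sqnorm x = 0 -> x = 0.
Proof.
move=> /eqP; rewrite psumr_eq0 => [/allP x0|j _]; last exact: sqr_ge0.
apply/rowP => j; rewrite mxE; apply/eqP; rewrite -sqrf_eq0.
exact: x0 (mem_index_enum _).
Qed.

Lemma sqnormN x : sqnorm (- x) = sqnorm x.
Proof. by apply: eq_bigr => j _; rewrite mxE sqrrN. Qed.

Lemma sqnormD_le x y : sqnorm (x + y) <= 2 * sqnorm x + 2 * sqnorm y.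
Proof.
rewrite /sqnorm !mulr_sumr -big_split/=; apply: ler_sum => j _.
rewrite mxE -subr_ge0 [leRHS](_ : _ = (x 0 j - y 0 j) ^+ 2) ?sqr_ge0//; ring.
Qed.

Lemma le_sqr_coord_sqnorm x j : x 0 j ^+ 2 <= sqnorm x.
Proof.
rewrite /sqnorm (bigD1 j)//= lerDl; apply: sumr_ge0 => i _; exact: sqr_ge0.
Qed.

(** Jensen's inequality: in each coordinate the gap between the two sides is the variance of the
    values under the weights [c]. *)
Lemma le_sqnorm_conv n (c : 'I_n -> R) (v : 'I_n -> 'rV[R]_d) :
  (forall i, 0 <= c i) -> \sum_(i < n) c i = 1 ->
  sqnorm (\sum_(i < n) c i *: v i) <= \sum_(i < n) c i * sqnorm (v i).
Proof.
move=> c_ge0 c1; rewrite /sqnorm.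
under [leRHS]eq_bigr do rewrite mulr_sumr.
rewrite exchange_big/=; apply: ler_sum => j _; rewrite summxE.
under [X in X ^+ 2]eq_bigr do rewrite mxE.
set a := \sum_(i < n) _; rewrite -subr_ge0.
suff -> : \sum_(i < n) c i * v i 0 j ^+ 2 - a ^+ 2 =
    \sum_(i < n) c i * (v i 0 j - a) ^+ 2.
  by apply: sumr_ge0 => i _; rewrite mulr_ge0// sqr_ge0.
under [RHS]eq_bigr do rewrite sqrrB mulrDr mulrBr.
rewrite big_split/= sumrB -mulr_suml c1 mul1r.
suff -> : \sum_(i < n) c i * (v i 0 j * a *+ 2) = a ^+ 2 *+ 2 by ring.
rewrite expr2 -mulrnAr [RHS]mulr_suml.
by apply: eq_bigr => i _; ring.
Qed.

Lemma edistance_ge0 x C : 0 <= edistance x C.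
Proof.
(* The infimum of the empty set is 0 by convention. *)
rewrite /edistance; have [->|/set0P C0] := eqVneq [set enorm (x - y) | y in C] set0.
  by rewrite inf0.
by apply: lb_le_inf => // _ [y _ <-]; exact: enorm_ge0.
Qed.

Lemma edistance_le x z C : C z -> edistance x C <= enorm (x - z).
Proof.
move=> Cz; apply: ge_inf; last by exists z.
by exists 0 => _ [y _ <-]; exact: enorm_ge0.
Qed.

Lemma sqr_edistance_le x z C : C z -> edistance x C ^+ 2 <= sqnorm (x - z).
Proof.
move=> Cz; rewrite -sqr_enorm ler_sqr ?nnegrE ?enorm_ge0 ?edistance_ge0//.
exact: edistance_le.
Qed.

(** Passes to the infimum in an estimate uniform in z, without choosing a nearest point of [C]. *)
Lemma le_sqr_edistance x C c : C !=set0 ->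
  (forall z, C z -> c <= sqnorm (x - z)) -> c <= edistance x C ^+ 2.
Proof.
move=> [z0 Cz0] cC; have [c0|c0] := leP c 0; first exact: le_trans (sqr_ge0 _).
rewrite -[c](sqr_sqrtr (ltW c0)) ler_sqr ?nnegrE ?edistance_ge0 ?sqrtr_ge0//.
apply: lb_le_inf; first by exists (enorm (x - z0)), z0.
by move=> _ [z Cz <-]; rewrite ler_sqrt ?sqnorm_ge0// cC.
Qed.

Lemma continuous_sum (U : topologicalType) n (f : 'I_n -> U -> R) :
  (forall i, continuous (f i)) -> continuous (fun u => \sum_(i < n) f i u).
Proof.
elim: n f => [|n IHn] f cf u.
  have -> : (fun u => \sum_(i < 0) f i u) = (fun=> 0).
    by apply/funext => ?; rewrite big_ord0.
  exact: cvg_cst.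
have -> : (fun u => \sum_(i < n.+1) f i u) =
    (fun u => \sum_(i < n) f (widen_ord (leqnSn n) i) u + f ord_max u).
  by apply/funext => ?; rewrite big_ord_recr.
by apply: cvgD; [apply: IHn => i; exact: cf|exact: cf].
Qed.

Lemma continuous_sqnorm (U : topologicalType) (f : U -> 'rV[R]_d) :
  (forall j, continuous (fun u => f u 0 j)) -> continuous (sqnorm \o f).
Proof.
move=> cf; apply: continuous_sum => j u.
by rewrite (_ : (fun _ => _) = (fun u => f u 0 j * f u 0 j))//; apply: cvgM; exact: cf.
Qed.

Lemma continuous_sqnormB z : continuous (fun x : 'rV[R]_d => sqnorm (x - z)).
Proof.
apply: (@continuous_sqnorm _ (fun x => x - z)) => j x.
rewrite (_ : (fun _ => _) = (fun u : 'rV[R]_d => u 0 j - z 0 j)).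
  have cj := @coord_continuous R 1 d 0 j x.
  exact: (cvgB cj (cvg_cst _)).
by apply/funext => u; rewrite !mxE.
Qed.

(** The ambient norm is the sup norm; each coordinate is at most the Euclidean norm, so [C] is
    bounded for it and Heine-Borel applies. *)
Lemma compact_sqnorm_le C M : closed C -> (forall x, C x -> sqnorm x <= M) ->
  compact C.
Proof.
move=> Ccl CM; apply: bounded_closed_compact => //.
exists (Num.sqrt M); split; first exact: num_real.
move=> N MN x Cx; rewrite /Num.norm/= mx_normrE.
apply: bigmax_le => [|[i j] _ /=]; first exact: le_trans (sqrtr_ge0 M) (ltW MN).
apply: le_trans (ltW MN); rewrite -sqrtr_sqr ler_wsqrtr//.
by rewrite ord1; exact: le_trans (le_sqr_coord_sqnorm _ _) (CM _ Cx).
Qed.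

End SquaredNorm.

(** * The residual and the extremal problem for its inverse *)

Section Residual.
Context {R : realType} {d m : nat}.
Variable T : 'I_m -> 'rV[R]_d -> 'rV[R]_d.
Hypothesis T_nonexp : forall i x y, sqnorm (T i x - T i y) <= sqnorm (x - y).
Local Notation F := (common_Fix T).

Definition residual x : R := \sum_(i < m) sqnorm (x - T i x).

Lemma residual_ge0 x : 0 <= residual x.
Proof. by apply: sumr_ge0 => i _; exact: sqnorm_ge0. Qed.

Lemma residual_eq0 x : residual x = 0 <-> F x.
Proof.
split=> [/eqP|Fx].
  rewrite psumr_eq0 => [/allP r0|i _]; last exact: sqnorm_ge0.
  move=> i _; have /eqP/sqnorm_eq0/eqP := r0 i (mem_index_enum _).
  by rewrite subr_eq0 => /eqP.
rewrite /residual big1// => i _.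
by have -> := Fx i I; rewrite subrr sqnorm0.
Qed.

(** Nonexpansiveness makes every coordinate of [T i] continuous: it varies by less than e on the
    Euclidean ball of radius e. *)
Lemma continuous_residual : continuous residual.
Proof.
suff cTi i : continuous (fun x : 'rV[R]_d => sqnorm (x - T i x)).
  exact: (@continuous_sum R _ m _ cTi).
suff cTij j : continuous (fun x : 'rV[R]_d => (x - T i x) 0 j).
  exact: (@continuous_sqnorm R d _ _ cTij).
move=> x; rewrite (_ : (fun _ => _) = (fun u : 'rV[R]_d => u 0 j - T i u 0 j)).
  have cj := @coord_continuous R 1 d 0 j x.
  suff cT : {for x, continuous (fun u => T i u 0 j)} by exact: (cvgB cj cT).
  apply/(@cvgrPdist_lt _ R^o _ (nbhs x) (nbhs_filter x)) => e e0.
  have /cvgr_lt/(_ (e ^+ 2)) := @continuous_sqnormB R d x x.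
  rewrite subrr sqnorm0 exprn_gt0// => /(_ isT).
  apply: filterS => y ye.
  suff : @Num.norm _ R (T i x 0 j - T i y 0 j) < e by [].
  rewrite -ltr_sqr ?nnegrE ?normr_ge0 ?(ltW e0)// real_normK ?num_real//.
  apply: le_lt_trans ye; rewrite -opprB sqrrN.
  apply: le_trans (T_nonexp i y x).
  by have := le_sqr_coord_sqnorm (T i y - T i x) j; rewrite !mxE.
by apply/funext => u; rewrite !mxE.
Qed.

(* The condition on z says that x lies at distance at least 1 / |s| from F. *)
Definition inv_residual M (s y : R) : Prop :=
  exists x, [/\ sqnorm x <= M,
    forall z, residual z = 0 -> 1 <= s * s * sqnorm (x - z) &
    y * residual x = 1].

(** The admissible points form a compact set, on which the continuous residual attains its minimum.
    The minimum is positive, since a zero x of the residual could be taken as z and would give 1 <=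
    0. *)
Lemma inv_residual_max M s : (exists y, inv_residual M s y) ->
  exists2 y, inv_residual M s y & forall y', inv_residual M s y' -> y' <= y.
Proof.
pose K := [set x | sqnorm x <= M /\
  forall z, residual z = 0 -> 1 <= s * s * sqnorm (x - z)].
have K_gt0 x : K x -> 0 < residual x.
  move=> [_ Kx]; rewrite lt_neqAle residual_ge0 andbT; apply/negP => /eqP r0.
  by have := Kx x (esym r0); rewrite subrr sqnorm0 mulr0 ler10.
move=> [y0 [x0 [x0M x0K _]]].
have cK : compact K.
  apply: (@compact_sqnorm_le _ _ _ M) => [|x []//].
  have -> : K = (sqnorm @^-1` [set r | r <= M]) `&`
      \bigcap_(z in [set z | residual z = 0])
        ((fun x => s * s * sqnorm (x - z)) @^-1` [set r | 1 <= r]).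
    by apply/seteqP; split.
  apply: closedI.
    apply: preimage_closed (@closed_le _ _) => x _.
    rewrite (_ : sqnorm = fun u => sqnorm (u - 0)); first exact: continuous_sqnormB.
    by apply/funext => u; rewrite subr0.
  apply: closed_bigI => z _; apply: preimage_closed (@closed_ge _ _) => x _.
  exact: (cvgM (cvg_cst _) (@continuous_sqnormB R d z x)).
have [|c /set_mem Kc cmin] := EVT_min_rV _ cK (continuous_subspaceT continuous_residual).
  by exists x0.
exists (residual c)^-1.
  by case: (Kc) => cM cF; exists c; split=> //; rewrite mulVf// gt_eqF// K_gt0.
move=> y' [x [xM xF yx]]; have Kx : K x by [].
have -> : y' = (residual x)^-1.
  by rewrite -[y']mulr1 -[X in _ * X](divff (lt0r_neq0 (K_gt0 _ Kx))) mulrA yx mul1r.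
by rewrite lef_pV2 ?posrE ?K_gt0// cmin// inE.
Qed.

End Residual.

(** * The Hoelder error bound from polynomial boundedness *)

Section Lojasiewicz.
Variables (R : realType) (d m : nat) (O : forall n, set (set 'rV[R]_n)).
Variable T : 'I_m -> 'rV[R]_d -> 'rV[R]_d.
Hypothesis omin : o_minimal O.
Hypothesis T_definable : forall i, definable_fun O (T i).
Hypothesis T_nonexp : forall i x y, sqnorm (T i x - T i y) <= sqnorm (x - y).
Local Notation F := (common_Fix T).
Local Notation residual := (residual T).
Local Notation inv_residual := (inv_residual T).

Lemma definable_sqnormB n (f g : 'rV[R]_n -> 'rV[R]_d) :
  definable_fun O f -> definable_fun O g ->
  definable_real O (fun u => sqnorm (f u - g u)).
Proof.
move=> Df Dg.
have Dj j : definable_real O (fun u => f u 0 j - g u 0 j).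
  by apply: (definable_sub omin);
    exact: (definable_real_comp omin _ (definable_coord omin j)).
have := definable_sum omin (fun j => definable_mul omin (Dj j) (Dj j)).
congr (definable_real _ _); apply/funext => u; apply: eq_bigr => j _.
by rewrite !mxE expr2.
Qed.

Lemma definable_id n : definable_fun O (fun x : 'rV[R]_n => x).
Proof. by apply: (definable_row omin) => j; exact: definable_coord. Qed.

Lemma definable_residual n (f : 'rV[R]_n -> 'rV[R]_d) :
  definable_fun O f -> definable_real O (fun u => residual (f u)).
Proof.
move=> Df; apply: (definable_real_comp omin Df); apply: (definable_sum omin) => i.
exact: definable_sqnormB (definable_id d) (T_definable i).
Qed.

(** The variables are laid out as s, y, x, z; the universal quantifier over z and then the
    existential one over x remove the last block of [d] coordinates. *)
Lemma definable_inv_residual M : O (1 + 1)%N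
  [set v : 'rV[R]_(1 + 1) | inv_residual M (v 0 (lshift 1 0)) (v 0 (rshift 1 0))].
Proof.
have Dl n k (h : 'rV[R]_n -> R) : definable_real O h ->
    definable_real O (fun v : 'rV[R]_(n + k) => h (lsubmx v)).
  exact: definable_real_comp (definable_lsubmx omin n k).
have Dz : O (1 + 1 + d + d)%N [set v : 'rV[R]_(1 + 1 + d + d) |
    residual (rsubmx v) = 0 -> 1 <=
      lsubmx (lsubmx v) 0 (lshift 1 0) * lsubmx (lsubmx v) 0 (lshift 1 0) *
      sqnorm (rsubmx (lsubmx v) - rsubmx v)].
  have Ds : definable_real O (fun v : 'rV[R]_(1 + 1 + d + d) =>
      lsubmx (lsubmx v) 0 (lshift 1 0)).
    exact: Dl (Dl _ _ _ (definable_coord omin _)).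
  have Dx := definable_comp omin (definable_lsubmx omin (1 + 1 + d) d)
    (definable_rsubmx omin (1 + 1) d).
  have Dzz := definable_rsubmx omin (1 + 1 + d) d.
  (* The implication is the union of the complement of its premise with its conclusion. *)
  have := omin_setU omin
    (omin_setC omin (definable_eq omin (definable_residual _ _ Dzz) (definable_cst omin _ 0)))
    (definable_le omin (definable_cst omin _ 1)
       (definable_mul omin (definable_mul omin Ds Ds) (definable_sqnormB _ _ _ Dx Dzz))).
  congr (O _ _); apply/seteqP; split=> v /=; first by case.
  by move=> imp; have [/imp|] := pselect (residual (rsubmx v) = 0); [right|left].
have Dx := definable_rsubmx omin (1 + 1) d.
have D1 : O (1 + 1 + d)%N [set v : 'rV[R]_(1 + 1 + d) | sqnorm (rsubmx v) <= M].
  have D0 : definable_fun O (fun v : 'rV[R]_(1 + 1 + d) => 0 : 'rV[R]_d).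
    apply: (definable_row omin) => j; have := @definable_cst _ _ omin (1 + 1 + d) 0.
    by congr (definable_real _ _); apply/funext => v; rewrite mxE.
  have := definable_le omin (definable_sqnormB _ _ _ Dx D0) (definable_cst omin _ M).
  by congr (O _ _); apply/seteqP; split=> v /=; rewrite subr0.
have D3 := definable_eq omin (definable_mul omin
  (Dl _ d _ (definable_coord omin (rshift 1 (0 : 'I_1))))
  (definable_residual _ _ Dx)) (definable_cst omin _ 1).
have := definable_exists omin (omin_setI omin D1
  (omin_setI omin (definable_forall omin Dz) D3)).
congr (O _ _); apply/seteqP; split=> v /=.
  move=> [x]; rewrite !(row_mxKl, row_mxKr) => -[xM [xz yx]]; exists x; split=> // z z0.
  by have := xz z; rewrite !(row_mxKl, row_mxKr); exact.
move=> [x [xM xz yx]]; exists x; rewrite !(row_mxKl, row_mxKr); do !split=> //.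
by move=> z; rewrite !(row_mxKl, row_mxKr); exact: xz.
Qed.

Lemma inv_residual_poly_bound M : polynomially_bounded O ->
  exists (N : nat) (s0 : R), 0 < s0 /\
    forall s y, s0 <= s -> inv_residual M s y -> y <= s ^+ N.
Proof.
move=> pb.
(* Graph of the function sending s to the largest value of [inv_residual M s], with default 0 where
   there is none: polynomial boundedness concerns functions defined on the whole line. *)
pose G (s y : R) := (inv_residual M s y /\
    forall y', inv_residual M s y' -> y' <= y) \/
  (y = 0 /\ forall y', ~ inv_residual M s y').
have exG s : exists y, G s y.
  have [/(inv_residual_max _ T_nonexp)[y Sy yM]|nS] :=
    pselect (exists y, inv_residual M s y).
    by exists y; left.
  by exists 0; right; split=> // y Sy; apply: nS; exists y.
have [f fG] := choice exG.
have Guniq s y y' : G s y -> G s y' -> y = y'.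
  move=> [[Sy yM]|[-> nS]] [[Sy' yM']|[-> nS']] //.
  - by apply/le_anti; rewrite yM' ?yM.
  - by have := nS' _ Sy.
  - by have := nS _ Sy'.
have Df : definable_fun O (fun x : 'rV[R]_1 => \row_(j < 1) f (x 0 0)).
  have DS := definable_inv_residual M.
  (* The coordinates are s, y and a competitor y', over which maximality and emptiness quantify. *)
  have DS' : O (1 + 1 + 1)%N [set v : 'rV[R]_(1 + 1 + 1) |
      inv_residual M (v 0 (lshift 1 (lshift 1 0))) (v 0 (rshift (1 + 1) 0))].
    have := definable_reindex2 omin (fun _ : 'I_1 => lshift 1 (lshift 1 (0 : 'I_1)))
      (fun _ : 'I_1 => rshift (1 + 1) (0 : 'I_1)) DS.
    by congr (O _ _); apply/seteqP; split=> v /=; rewrite row_mxEl row_mxEr !mxE.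
  have Dle := definable_le omin (definable_coord omin (rshift (1 + 1) (0 : 'I_1)))
    (definable_coord omin (lshift 1 (rshift 1 (0 : 'I_1)))).
  have Dmax := definable_forall omin (omin_setU omin (omin_setC omin DS') Dle).
  have Dempty := definable_forall omin (omin_setC omin DS').
  have D0 := definable_eq omin (definable_coord omin (rshift 1 (0 : 'I_1)))
    (definable_cst omin _ 0).
  have := omin_setU omin (omin_setI omin DS Dmax) (omin_setI omin D0 Dempty).
  rewrite /definable_fun; congr (O _ _).
  have GE (v : 'rV[R]_(1 + 1)) : (exists2 x : 'rV[R]_1, True &
      row_mx x (\row_(j < 1) f (x 0 0)) = v) <->
      G (v 0 (lshift 1 0)) (v 0 (rshift 1 0)).
    split=> [[x _ <-]|Gv]; first by rewrite row_mxEl row_mxEr mxE.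
    exists (lsubmx v) => //; rewrite -[RHS]hsubmxK; congr row_mx.
    apply/rowP => j; rewrite !mxE ord1; apply: Guniq (fG _) Gv.
  apply/seteqP; split=> v /=.
    move=> H; apply/GE; case: H => [[Sv vM]|[v0 vE]]; [left|right]; split=> //.
      move=> y' Sy'; have := vM (\row_j y').
      rewrite row_mxEr !row_mxEl mxE.
      by case.
    by move=> y' Sy'; apply: (vE (\row_j y')); rewrite row_mxEr !row_mxEl mxE.
  move=> /GE[[Sv vM]|[v0 vE]]; [left|right]; split=> // y;
    rewrite row_mxEr !row_mxEl //.
  by have [/vM|] := pselect (inv_residual M (v 0 (lshift 1 0)) (y 0 0)); [right|left].
(* The bound holds strictly beyond [s0]; the new threshold is positive and exceeds [s0]. *)
have [N [s0 [_ fN]]] := pb f Df; exists N, (Num.max s0 0 + 1).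
have s0_le : 0 <= Num.max s0 0 by rewrite le_max lexx orbT.
split=> [|s y ss Sy]; first by rewrite ltr_wpDl.
have s0s : s0 < s.
  by apply: lt_le_trans ss; rewrite ltr_pwDr// le_max lexx.
apply: le_trans (fN s s0s); apply: le_trans (ler_norm _).
by have [[_]|[_ /(_ y)]] := fG s; [apply|].
Qed.

(** With D the distance from x to [F] and s = max(s0, 1/D), the point x is admissible at level s, so
    1 <= s^N * residual x. Multiplying by D^N and using that s * D is bounded on the ball gives the
    estimate. *)
Lemma Lojasiewicz M : polynomially_bounded O -> F !=set0 ->
  exists (q : nat) (C : R), 0 < C /\ forall x, sqnorm x <= M ->
    (edistance x F ^+ 2) ^+ q.+2 <= C * residual x.
Proof.
move=> /(inv_residual_poly_bound M) [N [s0 [s0_gt0 SN]]] [p Fp].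
(* [L] bounds the distance to [F] on the ball, by comparison with the point [p]; adding 1 makes it
   positive. Below, [A] bounds s * D. *)
pose L := Num.sqrt (2 * M + 2 * sqnorm p) + 1.
have L_gt0 : 0 < L by rewrite ltr_wpDl// sqrtr_ge0.
pose A := Num.max (s0 * L) 1.
have A_gt0 : 0 < A by rewrite lt_max ltr01 orbT.
(* D^(2N + 4) splits as D^N, bounded through the residual, times D^(N + 4), bounded by L^(N + 4). An
   exponent of at least 2 in D^2 is what the recursion for the rate uses. *)
exists N, (A ^+ N * L ^+ (N + 4)); split; first by rewrite mulr_gt0 ?exprn_gt0.
move=> x xM; set D := edistance x F.
have [D0|D0] := eqVneq D 0.
  by rewrite D0 expr0n/= expr0n/= mulr_ge0 ?residual_ge0// mulr_ge0 ?exprn_ge0 ?ltW.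
have D_gt0 : 0 < D by rewrite lt_neqAle eq_sym D0 edistance_ge0.
have DL : D <= L.
  apply: le_trans (edistance_le x _ _ Fp) _; rewrite /L /enorm.
  apply: (@le_trans _ _ (Num.sqrt (2 * M + 2 * sqnorm p))); last by rewrite lerDl.
  apply: ler_wsqrtr; have := sqnormD_le x (- p); rewrite sqnormN => /le_trans; apply.
  by rewrite lerD2r ler_pM2l.
pose s := Num.max s0 D^-1.
have s_ge : s0 <= s by rewrite le_max lexx.
have s_gt0 : 0 < s by exact: lt_le_trans s_ge.
have sD1 : 1 <= s * D by rewrite -ler_pdivrMr// div1r le_max lexx orbT.
have sDA : s * D <= A.
  rewrite maxr_pMl ?(ltW D_gt0)// mulVf// ge_max; apply/andP; split; last first.
    by rewrite le_max lexx orbT.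
  by rewrite le_max ler_pM2l// DL.
have xK z : residual z = 0 -> 1 <= s * s * sqnorm (x - z).
  move=> /residual_eq0 Fz; apply: le_trans (_ : s * s * D ^+ 2 <= _).
    by rewrite -expr2 -exprMn exprn_ege1.
  by rewrite ler_pM2l ?mulr_gt0// sqr_edistance_le.
have r_gt0 : 0 < residual x.
  rewrite lt_neqAle residual_ge0 andbT eq_sym; apply/eqP => r0.
  by have := xK _ r0; rewrite subrr sqnorm0 mulr0 ler10.
have : (residual x)^-1 <= s ^+ N.
  by apply: SN => //; exists x; split=> //; rewrite mulVf// gt_eqF.
rewrite -div1r ler_pdivrMr// => r1.
have DN : D ^+ N <= A ^+ N * residual x.
  rewrite -[D ^+ N]mulr1; apply: le_trans (_ : D ^+ N * (s ^+ N * residual x) <= _).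
    by rewrite ler_pM2l ?exprn_gt0.
  rewrite mulrA -exprMn [D * s]mulrC ler_pM2r//.
  by rewrite lerXn2r ?nnegrE ?mulr_ge0 ?(ltW s_gt0) ?(ltW D_gt0) ?(ltW A_gt0).
have expE (a : R) k : (a ^+ 2) ^+ k.+2 = a ^+ k * a ^+ (k + 4).
  by rewrite -exprM -exprD mul2n -addnn !addnS !addSn addn0.
rewrite expE.
rewrite mulrAC; apply: ler_pM => //; rewrite ?exprn_ge0 ?(ltW D_gt0)//.
by rewrite lerXn2r ?nnegrE ?(ltW D_gt0) ?(ltW L_gt0).
Qed.

End Lojasiewicz.

(** * Quantitative inequalities for averaged maps *)

Section Averaged.
Variables (R : realType) (d : nat) (alpha : R) (T : 'rV[R]_d -> 'rV[R]_d).
Hypothesis alpha01 : 0 < alpha < 1.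
Hypothesis T_averaged : averaged alpha T.

Lemma sqnorm_barycenter (t : R) (a b : 'rV[R]_d) :
  sqnorm ((1 - t) *: a + t *: b) =
  (1 - t) * sqnorm a + t * sqnorm b - t * (1 - t) * sqnorm (a - b).
Proof.
rewrite /sqnorm !mulr_sumr -big_split -sumrB /=; apply: eq_bigr => j _.
by rewrite !mxE; ring.
Qed.

(** Here [b] is N x - N y for the nonexpansive part N; both differences become combinations of x - y
    and [b], ready for [sqnorm_barycenter]. *)
Lemma averaged_firm x y : exists b, sqnorm b <= sqnorm (x - y) /\
  T x - T y = (1 - alpha) *: (x - y) + alpha *: b /\
  (x - T x) - (y - T y) = alpha *: ((x - y) - b).
Proof.
have [N N_nonexp TE] := T_averaged; exists (N x - N y); split; last first.
  by rewrite !TE; split; apply/rowP => j; rewrite !mxE; ring.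
by rewrite -!sqr_enorm lerXn2r ?nnegrE ?enorm_ge0// N_nonexp.
Qed.

Lemma averaged_sqnorm_le x y : sqnorm (T x - T y) <= sqnorm (x - y).
Proof.
have [b [bxy [-> _]]] := averaged_firm x y; rewrite sqnorm_barycenter.
have [a0 a1] := andP alpha01.
have S0 : 0 <= alpha * (1 - alpha) * sqnorm (x - y - b).
  by rewrite !mulr_ge0 ?sqnorm_ge0 ?subr_ge0 ?ltW.
by have := ler_wpM2l (ltW a0) bxy; lra.
Qed.

(** The barycenter identity loses alpha (1 - alpha) |x - z - b|^2, and x - T x = alpha (x - z - b)
    turns this loss into the stated multiple of |x - T x|^2. *)
Lemma averaged_fixed_sqnorm_le x z : T z = z ->
  sqnorm (T x - z) + (1 - alpha) / alpha * sqnorm (x - T x) <= sqnorm (x - z).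
Proof.
move=> Tz; have [b [bxz []]] := averaged_firm x z; rewrite Tz subrr subr0 => -> ->.
rewrite sqnorm_barycenter; have [a0 a1] := andP alpha01.
have -> : sqnorm (alpha *: (x - z - b)) = alpha ^+ 2 * sqnorm (x - z - b).
  by rewrite /sqnorm mulr_sumr; apply: eq_bigr => j _; rewrite mxE exprMn.
have -> : (1 - alpha) / alpha * (alpha ^+ 2 * sqnorm (x - z - b)) =
    alpha * (1 - alpha) * sqnorm (x - z - b) by field; rewrite gt_eqF.
by rewrite subrK; have := ler_wpM2l (ltW a0) bxz; lra.
Qed.

End Averaged.

(** * Decrease of the distance along the quasi-cyclic iteration *)

Section QuasiCyclic.
Variables (R : realType) (d m : nat) (alpha : R).
Variables (T : 'I_m -> 'rV[R]_d -> 'rV[R]_d) (w : nat -> 'I_m -> R).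
Variable (x : nat -> 'rV[R]_d).
Hypothesis alpha01 : 0 < alpha < 1.
Hypothesis T_averaged : forall i, averaged alpha (T i).
Hypothesis xS : forall k, x k.+1 = \sum_(i < m) w k i *: T i (x k).
Hypothesis w_ge0 : forall k i, 0 <= w k i.
Hypothesis w_sum1 : forall k, \sum_(i < m) w k i = 1.
Hypothesis w_inf : 0 < weight_inf w.
Local Notation F := (common_Fix T).
Local Notation c := ((1 - alpha) / alpha).
Local Notation e k := (\sum_(i < m) w k i * sqnorm (x k - T i (x k))).

Let c_gt0 : 0 < c.
Proof. by have [? ?] := andP alpha01; rewrite divr_gt0// subr_gt0. Qed.

Lemma weight_inf_le k i : i \in Iplus w k -> weight_inf w <= w k i.
Proof.
move=> iw; apply: (@le_trans _ _ (\big[Num.min/1]_(i in Iplus w k) w k i)).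
  apply: ge_inf; last by exists k.
  by exists 0 => _ [l _ <-]; apply: le_bigmin => // j _; exact: w_ge0.
exact: bigmin_le_cond.
Qed.

(** Convexity of the squared norm reduces the step to the inequality for each [T i] at the fixed
    point z, summed with the weights. *)
Lemma sqnorm_step_fixed_le k z : F z ->
  sqnorm (x k.+1 - z) + c * e k <= sqnorm (x k - z).
Proof.
move=> Fz; have -> : x k.+1 - z = \sum_(i < m) w k i *: (T i (x k) - z).
  rewrite xS; under [RHS]eq_bigr do rewrite scalerBr.
  by rewrite sumrB -scaler_suml w_sum1 scale1r.
apply: le_trans (lerD (le_sqnorm_conv _ _ _ (w_ge0 k) (w_sum1 k)) (lexx _)) _.
rewrite mulr_sumr -big_split/= -[leRHS]mul1r -[X in _ <= X * _](w_sum1 k) mulr_suml.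
apply: ler_sum => i _; rewrite mulrCA -mulrDr ler_wpM2l//.
exact: (averaged_fixed_sqnorm_le _ _ _ _ alpha01 (T_averaged i) _ _ (Fz i I)).
Qed.

Lemma sqnorm_step_le k : sqnorm (x k.+1 - x k) <= e k.
Proof.
have -> : x k.+1 - x k = \sum_(i < m) w k i *: (T i (x k) - x k).
  rewrite xS; under [RHS]eq_bigr do rewrite scalerBr.
  by rewrite sumrB -scaler_suml w_sum1 scale1r.
apply: le_trans (le_sqnorm_conv _ _ _ (w_ge0 k) (w_sum1 k)) _.
by apply: ler_sum => i _; rewrite -opprB sqnormN.
Qed.

Lemma weighted_residual_ge0 k : 0 <= e k.
Proof. by apply: sumr_ge0 => i _; rewrite mulr_ge0 ?sqnorm_ge0. Qed.

Lemma sqnorm_fixed_nonincreasing z j k : F z -> (j <= k)%N ->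
  sqnorm (x k - z) <= sqnorm (x j - z).
Proof.
move=> Fz /subnKC <-; elim: (k - j)%N => [|n IHn]; first by rewrite addn0.
rewrite addnS; apply: le_trans IHn.
apply: le_trans (sqnorm_step_fixed_le _ _ Fz).
by rewrite lerDl mulr_ge0 ?weighted_residual_ge0// ltW.
Qed.

Section Block.
Variable s : nat.
Hypothesis cover : forall k, (\bigcup_(j < s) Iplus w (k + j))%SET = [set: 'I_m]%SET.

(** Each of the [m] terms of the residual costs 6 * 4^s + 3 / [weight_inf w], and division by c
    converts the decrease into a bound on weighted residuals; the added 1 gives positivity at
    once. *)
Let K := (m%:R * (6 * 4 ^+ s + 3 / weight_inf w) + 1) / c.

(** The decrease over the block controls every weighted residual in it, hence also the displacement
    from x k. Each index i is active at some time of the block, with weight at least [weight_inf w];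
    the bound on its residual there is carried back to x k by nonexpansiveness. *)
Lemma block_residual_le k z : F z ->
  residual T (x k) <= K * (sqnorm (x k - z) - sqnorm (x (k + s)%N - z)).
Proof.
move=> Fz; set Q := _ - _; pose E := Q / c.
(* By Fejér monotonicity one step decreases the squared distance to z by at most the total [Q]. *)
have eQ j : (j < s)%N -> e (k + j)%N <= E.
  move=> js; rewrite /E ler_pdivlMr// mulrC /Q lerBrDl.
  apply: le_trans (lerD (sqnorm_fixed_nonincreasing z (k + j).+1 _ Fz _) (lexx _)) _.
    by rewrite -addnS leq_add2l.
  apply: le_trans (sqnorm_step_fixed_le _ _ Fz) _.
  by apply: sqnorm_fixed_nonincreasing; rewrite ?leq_addr.
have Q_ge0 : 0 <= E.
  rewrite /E divr_ge0 ?(ltW c_gt0)// /Q subr_ge0.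
  by apply: sqnorm_fixed_nonincreasing; rewrite ?leq_addr.
(* The induction closes because 2 * 4^j + 2 <= 4^(j + 1). *)
have xkj j : (j <= s)%N -> sqnorm (x (k + j)%N - x k) <= 4 ^+ j * E.
  elim: j => [_|j IHj js]; first by rewrite addn0 subrr sqnorm0 mulr_ge0.
  have -> : x (k + j.+1)%N - x k = (x (k + j)%N - x k) + (x (k + j).+1 - x (k + j)%N).
    by rewrite addnS [RHS]addrC subrKA.
  apply: le_trans (sqnormD_le _ _) _.
  have := IHj (ltnW js); have := le_trans (sqnorm_step_le _) (eQ _ js).
  have : 1 <= 4 ^+ j :> R by rewrite exprn_ege1// ler1n.
  rewrite exprS; nra.
have xk_fix i : sqnorm (x k - T i (x k)) <= (6 * 4 ^+ s + 3 / weight_inf w) * E.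
  have /bigcupP[j _ ij] : i \in (\bigcup_(j < s) Iplus w (k + j))%SET.
    by rewrite cover inE.
  set y := x (k + j)%N.
  have yx : sqnorm (y - x k) <= 4 ^+ s * E.
    apply: le_trans (xkj j (ltnW (ltn_ord j))) _.
    by rewrite ler_wpM2r// ler_weXn2l ?ler1n// ltnW.
  have yT : sqnorm (y - T i y) <= E / weight_inf w.
    rewrite ler_pdivlMr// mulrC; apply: le_trans (eQ j (ltn_ord j)).
    rewrite (bigD1 i)//=; apply: ler_wpDr.
      by apply: sumr_ge0 => l _; rewrite mulr_ge0 ?sqnorm_ge0.
    by rewrite ler_wpM2r ?sqnorm_ge0// weight_inf_le.
  have Tyx := averaged_sqnorm_le _ _ _ _ alpha01 (T_averaged i) y (x k).
  (* x k - T i (x k) is split through y and T i y; the square of a sum of three terms is at most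
     three times the sum of their squares. The first and last terms together give 6 * 4^s. *)
  apply: (@le_trans _ _ (3 * sqnorm (y - x k) + 3 * sqnorm (y - T i y) +
      3 * sqnorm (T i y - T i (x k)))); last first.
    have -> : (6 * 4 ^+ s + 3 / weight_inf w) * E =
        6 * (4 ^+ s * E) + 3 * (E / weight_inf w) by ring.
    move: yx yT Tyx; lra.
  rewrite /sqnorm !mulr_sumr -!big_split/=; apply: ler_sum => l _; rewrite !mxE.
  move: (x k 0 l) (y 0 l) (T i y 0 l) (T i (x k) 0 l) => a b p q.
  rewrite -subr_ge0 [leRHS](_ : _ = (b - a + (b - p)) ^+ 2 +
    ((b - p) - (p - q)) ^+ 2 + ((b - a) + (p - q)) ^+ 2); last by ring.
  by rewrite !addr_ge0 ?sqr_ge0.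
apply: le_trans (ler_sum _ (fun i _ => xk_fix i)) _.
rewrite sumr_const card_ord /K -[leLHS]mulr_natl.
rewrite -[leRHS]mulrA [c^-1 * Q]mulrC -/E; nra.
Qed.

Lemma block_edistance_le : F !=set0 -> exists2 a, 0 < a & forall k,
  edistance (x (k + s)%N) F ^+ 2 <=
  edistance (x k) F ^+ 2 - a * residual T (x k).
Proof.
move=> F0; have K_gt0 : 0 < K.
  by rewrite divr_gt0// ltr_wpDl// mulr_ge0// addr_ge0 ?mulr_ge0 ?exprn_ge0 ?invr_ge0// ltW.
exists K^-1; first by rewrite invr_gt0.
move=> k; rewrite lerBrDr; apply: le_sqr_edistance => // z Fz.
apply: le_trans (lerD (sqr_edistance_le _ _ _ Fz) (lexx _)) _.
by rewrite -lerBrDl ler_pdivrMl// block_residual_le.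
Qed.

End Block.

Lemma edistance_nonincreasing j k : F !=set0 -> (j <= k)%N ->
  edistance (x k) F ^+ 2 <= edistance (x j) F ^+ 2.
Proof.
move=> F0 jk; apply: le_sqr_edistance => // z Fz.
exact: le_trans (sqr_edistance_le _ _ _ Fz) (sqnorm_fixed_nonincreasing _ _ _ Fz jk).
Qed.

End QuasiCyclic.

(** * A sublinear rate from a nonlinear recursion *)

Section Rate.
Variables (R : realType) (u : nat -> R) (a : R) (q s : nat).
Hypothesis (u_ge0 : forall k, 0 <= u k) (a_gt0 : 0 < a) (s_gt0 : (0 < s)%N).
Hypothesis u_noninc : forall j k, (j <= k)%N -> u k <= u j.
Hypothesis u_block : forall k, u (k + s)%N <= u k - a * u k ^+ q.+2.

(** For v = a u^(q + 1) the recursion gives v(l + s) <= v(l) (1 - v(l)), whence j v(j s) <= 1 by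
    induction; monotonicity then covers the times between multiples of s. *)
Lemma sublinear_rate k : (s <= k)%N -> a * u k ^+ q.+1 * k%:R <= 2 * s%:R.
Proof.
pose v k := a * u k ^+ q.+1.
have v_ge0 l : 0 <= v l by rewrite mulr_ge0 ?exprn_ge0// ltW.
have v_block l : v (l + s)%N <= v l * (1 - v l).
  have uv : u (l + s)%N <= u l * (1 - v l).
    by apply: le_trans (u_block l) _; rewrite mulrBr mulr1 /v [u l ^+ q.+2]exprS mulrCA.
  have [ul0|ul0] := eqVneq (u l) 0.
    have us0 : u (l + s)%N = 0.
      by apply/le_anti; rewrite u_ge0 andbT (le_trans uv)// ul0 mul0r.
    by rewrite /v us0 ul0 !expr0n/= mulr0 mul0r.
  have ul_gt0 : 0 < u l by rewrite lt_neqAle eq_sym ul0 u_ge0.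
  (* Since 0 <= u(l + s) <= u(l) (1 - v(l)), dividing by u(l) > 0 gives the sign. It yields (1 -
     v)^(q + 1) <= 1 - v below. *)
  have v1 : 0 <= 1 - v l.
    by rewrite -(pmulr_rge0 _ ul_gt0); exact: le_trans uv.
  rewrite /v -[leRHS]mulrA ler_pM2l// -/(v l).
  apply: (@le_trans _ _ ((u l * (1 - v l)) ^+ q.+1)).
    by rewrite lerXn2r ?nnegrE ?mulr_ge0.
  rewrite exprMn ler_wpM2l ?exprn_ge0// exprS ler_piMr// exprn_ile1//.
  by rewrite lerBlDr lerDl.
have vj j : v (j * s)%N * j%:R <= 1.
  elim: j => [|j IHj]; first by rewrite mulr0.
  rewrite mulSn addnC; apply: le_trans (ler_wpM2r _ (v_block _)) _ => //.
  have := v_ge0 (j * s)%N; have := v_ge0 (j * s + s)%N; have := v_block (j * s)%N.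
  rewrite -natr1; move: IHj; set V := v (j * s)%N; set J : R := j%:R => H1 H2 H3 H4.
  have V1 : V <= 1 by rewrite leNgt; apply/negP => V1; nra.
  (* V (1 - V) (J + 1) <= (1 - V) + V (1 - V) = 1 - V^2 <= 1. *)
  have : (V * J) * (1 - V) <= 1 * (1 - V) by rewrite ler_wpM2r// subr_ge0.
  nra.
move=> sk.
(* For k >= s the quotient k / s is at least 1, so k < s (k / s + 1) <= 2 s (k / s), with integer
   division. *)
apply: (@le_trans _ _ (v k * (2 * s%:R * (k %/ s)%:R))).
  rewrite -/(v k) ler_wpM2l//.
  have -> : 2 * s%:R * (k %/ s)%:R = (2 * s * (k %/ s))%:R :> R by rewrite !natrM.
  rewrite ler_nat.
  have := divn_eq k s; have := ltn_pmod k s_gt0.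
  have : (0 < k %/ s)%N by rewrite divn_gt0.
  nia.
rewrite mulrCA ler_piMr ?mulr_ge0//; apply: le_trans (vj (k %/ s)%N).
rewrite ler_wpM2r// ler_pM2l// lerXn2r ?nnegrE// u_noninc//.
exact: leq_trunc_div.
Qed.

End Rate.

(** * The power rate for the iterates *)

Theorem corollary5p11 (R : realType) (d m : nat) (alpha : R)
  (T : 'I_m -> 'rV[R]_d -> 'rV[R]_d)
  (w : nat -> 'I_m -> R) (x : nat -> 'rV[R]_d) (B : set 'rV[R]_d)
  (O : forall n, set (set 'rV[R]_n)) :
  (0 < m)%N ->
  0 < alpha < 1 ->
  (forall i, averaged alpha (T i)) ->
  common_Fix T !=set0 ->
  common_Fix T <> setT ->
  (forall k, x k.+1 = \sum_(i < m) w k i *: T i (x k)) ->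
  (forall k i, 0 <= w k i) ->
  (forall k, \sum_(i < m) w k i = 1) ->
  0 < weight_inf w ->
  ebounded B ->
  (forall k, B (x k)) ->
  jointly_Karamata_regular T B ->
  (exists2 s : nat, (0 < s)%N &
     forall k, (\bigcup_(j < s) Iplus w (k + j))%SET = [set: 'I_m]%SET) ->
  o_minimal O ->
  polynomially_bounded O ->
  (forall i, definable_fun O (T i)) ->
  (exists2 xs : 'rV[R]_d, common_Fix T xs & \forall k \near \oo, x k = xs) \/
  (exists r kappa : R, [/\ 0 < r, 0 < kappa &
     \forall k \near \oo,
       edistance (x k) (common_Fix T) <= kappa * k%:R `^ (- r)]).
Proof.
move=> _ alpha01 T_averaged F0 _ xS w_ge0 w_sum1 w_inf [M BM] Bx _ [s s_gt0 cover].
move=> omin pb T_definable; right; set F := common_Fix T.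
have T_nonexp i y z : sqnorm (T i y - T i z) <= sqnorm (y - z).
  exact: averaged_sqnorm_le alpha01 (T_averaged i) y z.
have [q [C [C_gt0 loj]]] := Lojasiewicz _ _ _ _ _ omin T_definable T_nonexp (M ^+ 2) pb F0.
have [b b_gt0 blk] := block_edistance_le _ _ _ _ _ _ _ alpha01 T_averaged xS w_ge0
  w_sum1 w_inf _ cover F0.
pose u k := edistance (x k) F ^+ 2; pose a := b / C.
(* The block decrease is b times the residual, and the error bound makes the residual at least u^(q
   + 2) / C; hence a = b / C. *)
have a_gt0 : 0 < a by rewrite divr_gt0.
have u_block k : u (k + s)%N <= u k - a * u k ^+ q.+2.
  apply: le_trans (blk k) _; rewrite lerB// /a -mulrA ler_pM2l// ler_pdivrMl//.
  apply: loj; rewrite -sqr_enorm lerXn2r ?nnegrE ?enorm_ge0 ?BM//.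
  exact: le_trans (enorm_ge0 _) (BM _ (Bx k)).
have rate := sublinear_rate _ u a q s (fun k => sqr_ge0 _) a_gt0 s_gt0
  (fun j k => edistance_nonincreasing _ _ _ _ _ _ _ alpha01 T_averaged xS w_ge0
    w_sum1 j k F0) u_block.
(* The rate reads D^p <= K / k for D the distance of x k to [F]; taking p-th roots gives r = 1/p and
   kappa = K^(1/p). *)
pose p : R := (2 * q.+1)%:R; pose K := 2 * s%:R / a.
have p_gt0 : 0 < p by rewrite ltr0n.
have K_gt0 : 0 < K by rewrite divr_gt0// mulr_gt0// ltr0n.
exists p^-1, (K `^ p^-1); split; rewrite ?invr_gt0 ?powR_gt0//.
near=> k.
have sk : (s <= k)%N by near: k; exact: nbhs_infty_ge.
have k_gt0 : 0 < k%:R :> R by rewrite ltr0n (leq_trans s_gt0).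
have D_ge0 := edistance_ge0 (x k) F.
have -> : edistance (x k) F = (u k ^+ q.+1) `^ p^-1.
  by rewrite /u -exprM -powR_mulrn// -powRrM divff ?gt_eqF// powRr1.
rewrite powRN ler_pdivlMr ?powR_gt0// -powRM ?exprn_ge0 ?sqr_ge0//.
apply: ge0_ler_powR; rewrite ?nnegrE ?(ltW K_gt0) ?invr_ge0 ?(ltW p_gt0)//.
  by rewrite mulr_ge0 ?exprn_ge0 ?sqr_ge0.
by rewrite ler_pdivlMr// mulrC mulrA rate.
Unshelve. all: by end_near.
Qed.
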